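(* There exist functions $n,\ell:\mathbb{N}\to\mathbb{N}$ with $n(k)=O(k\log^{13}k)$ and $\ell(k)=O(k\log k\,\log\log k)$ as $k\to\infty$, such that for every $k$, every group $G$ of rank $k$ and every generating set $S$ of $G$ of size $k$, there is a (multi-)subset $A$ of $G$ with $|A|\le n(k)$, $L_{G,S}(A)\le \ell(k)$ and $\delta(A;G)\ge\frac1{32}$.
   Context: The rank of a finitely generated group $G$ is the minimal size of a generating set of $G$. A multi-subset of $G$ is a finite unordered collection of elements of $G$, possibly with repetitions; sizes are counted with multiplicity, and $A\cap H$ is the multi-set of elements of $A$ lying in $H$. The detection probability of $A$ is $\delta(A;G)=\inf\{1-\frac{|A\cap H|}{|A|} : H\lneq G\}$, over all proper subgroups $H$ of $G$; thus $\delta(A;G)\ge\delta$ means $|A\cap H|\le(1-\delta)|A|$ for every proper subgroup $H$. For a generating set $S$ of $G$, the length $L_{G,S}(A)$ is the smallest $\ell$ such that every element of $A$ can be written as a word of length at most $\ell$ in $S\cup S^{-1}$. *)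

(* Defs.v *)
From HB Require Import structures.
From mathcomp Require Import all_boot all_order all_algebra.
From mathcomp Require Import finmap multiset.
From mathcomp Require Import all_classical all_reals all_analysis.

Set Implicit Arguments.
Unset Strict Implicit.
Unset Printing Implicit Defensive.

Import Order.TTheory GRing.Theory Num.Theory.
Import numFieldNormedType.Exports.
Local Open Scope mset_scope.

Definition is_least (P : nat -> Prop) (m : nat) : Prop :=
  P m /\ forall i, P i -> m <= i.

Definition generates (G : groupType) (S : {fset G}) : Prop :=
  forall H : {pred G}, group_closed H -> {subset S <= H} -> forall x, x \in H.

Definition is_rank (G : groupType) (k : nat) : Prop :=
  is_least (fun i => exists S : {fset G}, generates S /\ #|` S| = i) k.

Definition is_word (G : groupType) (S : {fset G}) (w : seq G) : bool :=
  all (fun y => (y \in S) || (y^-1 \in S)%g) w.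

Definition is_length (G : groupType) (S : {fset G}) (A : {mset G}) (l : nat) :
    Prop :=
  is_least (fun i => forall x, x \in A ->
    exists w : seq G, [/\ is_word S w, size w <= i & x = (\prod_(y <- w) y)%g]) l.

Definition proper_subgroup (G : groupType) (H : {pred G}) : Prop :=
  group_closed H /\ exists x, x \notin H.

(* The infimum is taken in [\bar R]; it is [+oo] when [G] is trivial, since
   [G] then has no proper subgroup.  The ratio is meaningful only for nonempty
   [A]: division by zero makes it [0] when [A] is empty. *)
Definition detection (R : realType) (G : groupType) (A : {mset G}) : \bar R :=
  ereal_inf [set (1 - (size [seq x <- A | x \in H])%:R / (size A)%:R)%R%:E
            | H in @proper_subgroup G]%classic.

(* Main.v *)
(* Call a word in the elements of a list X "once-hitting" for a proper subgroup
   H if exactly one of its letters lies outside H; its product is then outside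
   H.  If a proportion about 2 ^ - j of X lies outside H, a random word of
   length 2 ^ j is once-hitting with probability at least 1 / 8.  Whether a word
   is once-hitting depends only on which positions of X lie outside H, so a union
   bound over the 2 ^ |X| sets of positions gives 48 |X| words of length 2 ^ j,
   1 / 16 of which are once-hitting for every such H.

   Taking X = S, |S| = k, and all O(log k) scales j together produces a list Y of
   O(k log k) words of length at most k, of which a proportion of order 1 / log k
   lies outside any proper subgroup.  Now apply the same to Y with the
   O(log log k) scales that can occur; instead of concatenating the families,
   put them side by side and replace the i-th tuple of words by all its O(log k)
   subproducts, at least half of which lie outside H as soon as one entry does.
   This leaves a proportion at least 1 / 32 outside H, with O(k log^2 k) words of
   length O(k log k). *)
Require Import Defs.
From HB Require Import structures.
From mathcomp Require Import all_boot all_order all_algebra.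
From mathcomp Require Import finmap multiset.
From mathcomp Require Import all_classical all_reals all_analysis.
From mathcomp Require Import zify lra.

Set Implicit Arguments.
Unset Strict Implicit.
Unset Printing Implicit Defensive.

Import Order.TTheory GRing.Theory Num.Theory.
Import numFieldNormedType.Exports.
Local Open Scope classical_set_scope.
Local Open Scope mset_scope.
Local Open Scope ring_scope.

(** * Counting words with exactly one letter in a given set *)

Section Words.
Local Open Scope nat_scope.
Variable T : eqType.

Fixpoint words (r : seq T) (m : nat) : seq (seq T) :=
  if m is m'.+1 then [seq x :: w | x <- r, w <- words r m'] else [:: [::]].

Lemma size_words r m : size (words r m) = size r ^ m.
Proof. by elim: m => //= m IH; rewrite size_allpairs IH expnS. Qed.

Lemma words_size r m w : w \in words r m -> size w = m.
Proof.
by elim: m w => [|m IH] w /=; [rewrite inE => /eqP-> | case/allpairsP=> -[x v] /= [_ /IH<- ->]].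
Qed.

Definition hits_once (a : pred T) (w : seq T) := count a w == 1.

Lemma count_words_cons (P : pred (seq T)) r m :
  count P (words r m.+1) =
  \sum_(x <- r) count (fun w => P (x :: w)) (words r m).
Proof.
rewrite /= count_flatten sumnE !big_map.
by apply: eq_bigr => x _; rewrite count_map.
Qed.

Lemma sum_pred_nat (a : pred T) (r : seq T) c d :
  \sum_(x <- r) (if a x then c else d) = count a r * c + (size r - count a r) * d.
Proof.
elim: r => [|x r IH] /=; first by rewrite big_nil.
rewrite big_cons IH; case: (a x) => /=.
  by rewrite add1n subSS mulSn addnA.
by rewrite add0n subSn ?count_size // mulSn addnCA.
Qed.

Lemma count_words_miss (a : pred T) r m :
  count (fun w => count a w == 0) (words r m) = (size r - count a r) ^ m.
Proof.
elim: m => // m IH; rewrite count_words_cons expnS -IH.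
transitivity (count a r * 0 + (size r - count a r) *
  count (fun w => count a w == 0) (words r m)); last by rewrite muln0.
rewrite -sum_pred_nat.
apply: eq_bigr => x _; case: ifP => ax; last first.
  by apply: eq_count => w /=; rewrite ax.
rewrite -[in RHS](count_pred0 (words r m)); apply: eq_count => w /=.
by rewrite ax.
Qed.

Lemma count_words_once (a : pred T) r m :
  count (hits_once a) (words r m.+1) =
  m.+1 * count a r * (size r - count a r) ^ m.
Proof.
(* Split on the first letter: if it satisfies [a] the remaining letters must all miss, otherwise
   they must hit exactly once. *)
suff E n : count (hits_once a) (words r n.+1) =
    count a r * (size r - count a r) ^ n
    + (size r - count a r) * count (hits_once a) (words r n).
  elim: m => [|m IH]; rewrite E; first by rewrite /= muln0 addn0 mul1n.
  rewrite IH !expnS; lia.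
rewrite count_words_cons -count_words_miss -sum_pred_nat.
apply: eq_bigr => x _; case: ifP => ax; apply: eq_count => w;
  by rewrite /hits_once /= ax.
Qed.

(* Bernoulli: [(1 - t / N) ^ m >= 1 - m * t / N >= 1 / 2]. *)
Lemma half_le_miss N t m : 2 * m * t <= N -> N ^ m <= 2 * (N - t) ^ m.
Proof.
move=> h; suff B p : p * t <= N -> N ^ p * (N - p * t) <= N * (N - t) ^ p.
  case: (posnP N) => [N0|Np]; first by rewrite N0 sub0n; case: (m) => //= n; rewrite exp0n.
  have := B m ltac:(lia); have : N <= 2 * (N - m * t) by lia.
  set u := N - _; move=> Hu Hb.
  by rewrite -(leq_pmul2l Np) mulnC (leq_trans (leq_mul (leqnn _) Hu)) //; nia.
elim: p => [|p IH] hp; first by rewrite mul0n subn0 mulnC.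
have {}IH := IH ltac:(nia).
rewrite !expnS.
have -> : N * ((N - t) * (N - t) ^ p) = (N * (N - t) ^ p) * (N - t) by lia.
apply: leq_trans (leq_mul IH (leqnn _)).
rewrite (mulnC N) -!mulnA leq_mul2l; apply/orP; right.
have -> : p.+1 * t = p * t + t by lia.
move: hp; set q := p * t => hp.
have hpq : q + t <= N by rewrite /q; lia.
have [s ->] : exists s, N = q + t + s by exists (N - (q + t)); lia.
have -> : q + t + s - (q + t) = s by lia.
have -> : q + t + s - q = t + s by lia.
have -> : q + t + s - t = q + s by lia.
nia.
Qed.

(** Put [m = 2 ^ j], [N = size r], [t = count a r]. Exactly [m * t * (N - t) ^ (m - 1)] words hit
    once. The lower bound on [t] makes [m * t] at least half of [N - t], and the upper bound makes
    [(N - t) ^ m] at least a quarter of [N ^ m]. *)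
Lemma eighth_hits_once (a : pred T) r j :
  2 ^ j * count a r <= size r -> size r < 2 ^ j.+1 * count a r ->
  size (words r (2 ^ j)) <= 8 * count (hits_once a) (words r (2 ^ j)).
Proof.
set N := size r; set t := count a r => h1 h2.
rewrite size_words -/N.
case: j h1 h2 => [|j] h1 h2.
  by rewrite expn0 (count_words_once a r 0) -/t; lia.
have pe : 0 < 2 ^ j by rewrite expn_gt0.
set m := 2 ^ j in pe.
have e2 : 2 ^ j.+1 = (2 * m).-1.+1 by rewrite expnS -/m; lia.
rewrite e2 count_words_once -/N -/t -e2 expnS -/m.
(* At full length [2 * m] the condition of [half_le_miss] may fail, so it is applied at half the
   length and squared, which costs the factor 4. *)
have H := @half_le_miss N t m ltac:(move: h1; rewrite expnS -/m; lia).
have H2 : N ^ (2 * m) <= 4 * (N - t) ^ (2 * m).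
  by rewrite mulnC !expnM; nia.
have Nt : N - t <= 2 * (2 * m) * t by move: h2; rewrite !expnS -/m; lia.
apply: (leq_trans H2).
have -> : (N - t) ^ (2 * m) = (N - t) * (N - t) ^ (2 * m).-1.
  by rewrite -expnS; congr (_ ^ _); lia.
set E := _ ^ _.-1; have := leq_mul Nt (leqnn E); lia.
Qed.
End Words.

(** * Greedy choice of few words that serve all sets of positions at once *)

Lemma exists_le_average (F : realFieldType) (X : eqType) (r : seq X)
    (f : X -> F) (c : F) :
  (0 < size r)%N -> \sum_(x <- r) f x <= (size r)%:R * c ->
  exists2 x, x \in r & f x <= c.
Proof.
move=> r0 le_sum; apply: contrapT => no_x.
suff : (size r)%:R * c < \sum_(x <- r) f x by rewrite ltNge le_sum.
have lt_f x : x \in r -> c < f x.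
  by move=> xr; rewrite ltNge; apply/negP => fx; apply: no_x; exists x.
case: r r0 lt_f {le_sum no_x} => // x r _ lt_f.
rewrite big_cons /= -natr1 mulrDl mul1r addrC ltr_leD //.
  by rewrite lt_f ?mem_head.
rewrite mulr_natl -iter_addr_0 -count_predT -big_const_seq [leLHS]big_seq [leRHS]big_seq.
by apply: ler_sum => y yr; rewrite ltW // lt_f // inE yr orbT.
Qed.

(** Each unit of [N] costs a factor 2 in the union bound and buys 48 picks at rate [15 / 16]; the
    remaining [2 ^ - 3] yields three guaranteed hits. The power is bounded by repeated squaring,
    rounding up to small fractions. *)
Lemma greedy_rate (F : realFieldType) : (15 / 16) ^+ 48 * 2 <= 2^-1 ^+ 3 :> F.
Proof.
have sq n (x y : F) : 0 <= x -> (15 / 16) ^+ n <= x -> x * x <= y ->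
    (15 / 16) ^+ (n * 2) <= y.
  by move=> x0 le1; apply: le_trans; rewrite exprM expr2 ler_pM ?exprn_ge0.
have e2 := sq 1%N (15 / 16) (22 / 25) ltac:(lra) ltac:(by []) ltac:(lra).
have e4 := sq 2%N (22 / 25) (31 / 40) ltac:(lra) e2 ltac:(lra).
have e8 := sq 4%N (31 / 40) (61 / 100) ltac:(lra) e4 ltac:(lra).
have e16 := sq 8%N (61 / 100) (3 / 8) ltac:(lra) e8 ltac:(lra).
rewrite -[48%N]/(16 * 3)%N exprM.
have := @lerXn2r F 3 ((15 / 16) ^+ 16) (3 / 8).
rewrite !nnegrE exprn_ge0 // => /(_ erefl ltac:(lra) e16).
have -> : (3 / 8) ^+ 3 = 27 / 512 :> F by rewrite !exprS expr0; lra.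
have -> : 2^-1 ^+ 3 = 8^-1 :> F by rewrite !exprS expr0; lra.
set u := (_ ^+ 3); lra.
Qed.

Section Greedy.
Variables (F : realFieldType) (X : eqType) (T : finType) (P : pred T) (good : T -> pred X).
Variable r : seq X.
Hypothesis r_gt0 : (0 < size r)%N.
Hypothesis often_good : forall t, P t -> (size r <= 8 * count (good t) r)%N.

(* Each new element is picked, by averaging, so that the potential
   [\sum_t 2 ^ - (number of hits of t)] drops by a factor [15 / 16]. *)
Lemma greedy_potential n :
  exists s : seq X, [/\ size s = n, {subset s <= r} &
    \sum_(t | P t) 2^-1 ^+ count (good t) s <= (15 / 16) ^+ n * #|T|%:R :> F].
Proof.
elim: n => [|n [s [szs sr les]]].
  exists [::]; split=> //=.
  by rewrite !expr0 mul1r sumr_const ler_nat max_card.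
pose w t : F := 2^-1 ^+ count (good t) s.
have [|x xr lex] := @exists_le_average F X r
  (fun x => \sum_(t | P t) (if good t x then 2^-1 else 1) * w t)
  (15 / 16 * \sum_(t | P t) w t) r_gt0.
  rewrite exchange_big /= mulrA mulr_sumr; apply: ler_sum => t Pt.
  rewrite -mulr_suml ler_wpM2r ?exprn_ge0 ?invr_ge0 //.
  (* The factor averages to [1 - p / 2], where [p >= 1 / 8] is the proportion of good elements;
     hence [15 / 16]. *)
  have -> : \sum_(x <- r) (if good t x then 2^-1 else 1) =
      (size r)%:R - (count (good t) r)%:R / 2 :> F.
    elim: (r) => [|x r' IH] /=; first by rewrite big_nil; lra.
    by rewrite big_cons IH -[(size r').+1]addn1 !natrD; case: (good t x) => /=; lra.
  have := often_good Pt; rewrite -(ler_nat F) natrM; lra.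
exists (x :: s); split=> /=; first by rewrite szs.
  by move=> y; rewrite inE => /predU1P[->|/sr].
rewrite (eq_bigr (fun t => (if good t x then 2^-1 else 1) * w t)); last first.
  by move=> t _; rewrite exprD; case: (good t x); rewrite ?expr1 ?expr0.
by rewrite (le_trans lex) // exprS -[leRHS]mulrA ler_wpM2l.
Qed.

(** A single term of the potential is at most the whole, which [48 * N] picks bring down to
    [2 ^ - (3 * N)]; fewer than [3 * N] hits would make that term larger. *)
Lemma greedy_choice (N : nat) : (#|T| <= 2 ^ N)%N ->
  exists s : seq X, [/\ size s = (48 * N)%N, {subset s <= r} &
    forall t, P t -> (3 * N <= count (good t) s)%N].
Proof.
move=> leT; have [s [szs sr les]] := greedy_potential (48 * N).
exists s; split=> // t Pt; rewrite leqNgt; apply/negP => ltc.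
have : 2^-1 ^+ count (good t) s <= (15 / 16) ^+ (48 * N) * 2 ^+ N :> F.
  apply: le_trans (_ : \sum_(t | P t) 2^-1 ^+ count (good t) s <= _).
    by rewrite (bigD1 t) //= lerDl sumr_ge0 // => *; rewrite exprn_ge0.
  rewrite (le_trans les) // ler_wpM2l ?exprn_ge0 //.
  by rewrite -natrX ler_nat.
rewrite exprM -exprMn => le1.
have lt3 : 2^-1 ^+ (3 * N) < 2^-1 ^+ count (good t) s :> F.
  by rewrite ltr_iXn2l ?invr_gt0 ?invf_lt1 ?ltr1n //.
have := lt_le_trans lt3 le1; rewrite exprM ltNge => /negP[].
by rewrite lerXn2r ?greedy_rate // nnegrE ?mulr_ge0 ?exprn_ge0.
Qed.
End Greedy.

(** [I] will index the positions of a list and [T] those outside a subgroup. Working with positions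
    lets repeated entries count with multiplicity. *)
Lemma scale_family (I : finType) (j : nat) : (0 < #|I|)%N ->
  exists s : seq (seq I), [/\ size s = (48 * #|I|)%N,
    forall w, w \in s -> size w = (2 ^ j)%N &
    forall T : {set I}, (2 ^ j * #|T| <= #|I| < 2 ^ j.+1 * #|T|)%N ->
      (3 * #|I| <= count (hits_once (mem T)) s)%N].
Proof.
move=> I0; set r := words (enum I) (2 ^ j).
have r0 : (0 < size r)%N by rewrite size_words -cardE expn_gt0 I0.
have countT (T : {set I}) : count (mem T) (enum I) = #|T|.
  by rewrite cardE -size_filter enumT.
have [||s [szs sr sP]] := @greedy_choice rat (seq I) {set I}
    (fun T => 2 ^ j * #|T| <= #|I| < 2 ^ j.+1 * #|T|)%N
    (fun T : {set I} => hits_once (mem T)) r r0 _ #|I|.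
- by move=> T /andP[h1 h2]; apply: eighth_hits_once; rewrite countT -cardE.
- by rewrite -cardsT -powersetT card_powerset cardsT.
by exists s; split=> // w /sr /words_size.
Qed.

(** * Products in a group that escape a subgroup *)

Section Groups.
Local Open Scope nat_scope.
Local Open Scope group_scope.

Variable G : groupType.
Implicit Types (H : {pred G}) (X Y w s : seq G).

Definition outside H : pred G := fun x => x \notin H.
Arguments outside H x /.

Lemma mem_mul_closedl H x y : group_closed H -> x \in H -> (x * y \in H) = (y \in H).
Proof.
move=> gH xH; have M := group_closedM gH.
apply/idP/idP => [xyH|]; last exact: M.
by rewrite -(mulKg x y); apply: M => //; apply: (group_closedV gH).
Qed.

Lemma mem_mul_closedr H x y : group_closed H -> y \in H -> (x * y \in H) = (x \in H).
Proof.
move=> gH yH; have M := group_closedM gH.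
apply/idP/idP => [xyH|xH]; last exact: M.
by rewrite -(mulgK y x); apply: M => //; apply: (group_closedV gH).
Qed.

Lemma prod_closed H w : group_closed H -> count (outside H) w = 0%N ->
  \prod_(x <- w) x \in H.
Proof.
move=> gH; elim: w => [|x w IH] /=; first by rewrite big_nil gH.1.
rewrite big_cons; case: (boolP (x \in H)) => //= xH w0.
by rewrite mem_mul_closedl ?IH.
Qed.

(** The letters on either side of the exceptional one lie in [H], and multiplying by elements of [H]
    does not affect membership. *)
Lemma prod_outside H w : group_closed H -> hits_once (outside H) w ->
  \prod_(x <- w) x \notin H.
Proof.
move=> gH; rewrite /hits_once; elim: w => [|x w IH] //=; rewrite big_cons.
case: (boolP (x \in H)) => /= xH; first by rewrite add0n mem_mul_closedl.
by rewrite add1n eqSS => /eqP /(prod_closed gH) wH; rewrite mem_mul_closedr.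
Qed.

Definition short_product X (m : nat) (y : G) :=
  exists w, [/\ {subset w <= X}, size w <= m & y = \prod_(x <- w) x].

Lemma short_product1 X m : short_product X m 1.
Proof. by exists [::]; rewrite big_nil; split. Qed.

Lemma short_product_leq X m n y : m <= n -> short_product X m y -> short_product X n y.
Proof. by move=> mn [w [wX wm ->]]; exists w; split=> //; apply: leq_trans mn. Qed.

Lemma short_productM X m n x y : short_product X m x -> short_product X n y ->
  short_product X (m + n) (x * y).
Proof.
move=> [v [vX vm ->]] [w [wX wn ->]]; exists (v ++ w); rewrite big_cat size_cat.
by split=> //; [move=> z; rewrite mem_cat => /orP[/vX|/wX] | apply: leq_add].
Qed.

Lemma short_product_comp X Y m n y :
  (forall x, x \in Y -> short_product X m x) -> short_product Y n y ->
  short_product X (n * m) y.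
Proof.
move=> YX [w [wY wn ->]]; apply: short_product_leq (leq_mul wn (leqnn m)) _.
elim: w wY {wn} => [|x w IH] wY; first by rewrite big_nil; apply: short_product1.
rewrite big_cons /= mulSn; apply: short_productM; first by apply: YX; rewrite wY ?mem_head.
by apply: IH => z zw; rewrite wY // inE zw orbT.
Qed.

Lemma scale_products X j : 0 < size X ->
  exists Y, [/\ size Y = (48 * size X)%N,
    forall y, y \in Y -> short_product X (2 ^ j)%N y &
    forall H, group_closed H ->
      (2 ^ j * count (outside H) X <= size X < 2 ^ j.+1 * count (outside H) X)%N ->
      (3 * size X <= count (outside H) Y)%N].
Proof.
move=> X0; have [|s [szs sw sP]] := @scale_family 'I_(size X) j.
  by rewrite card_ord.
rewrite card_ord in szs sP.
pose val_word (u : seq 'I_(size X)) := [seq tnth (in_tuple X) i | i <- u].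
exists [seq \prod_(x <- val_word u) x | u <- s]; split.
- by rewrite size_map.
- move=> y /mapP[w ws ->]; exists (val_word w); split=> //.
    by move=> x /mapP[i _ ->]; apply: mem_tnth.
  by rewrite size_map (sw w ws).
move=> H gH; pose T : {set 'I_(size X)} :=
  [set i | tnth (in_tuple X) i \notin H]%SET.
have inT i : (i \in T) = (tnth (in_tuple X) i \notin H) by rewrite inE.
have -> : count (outside H) X = #|T|.
  transitivity (count (outside H) (tval (in_tuple X))) => //.
  rewrite -map_tnth_enum count_map.
  rewrite cardE -size_filter enumT; congr size; apply: eq_filter => i.
  exact/esym/inT.
move=> /sP /leq_trans; apply; rewrite count_map; apply: sub_count => w /= Tw.
apply: prod_outside => //; rewrite /hits_once count_map -(eqP Tw).
by apply/eqP; apply: eq_count => i; apply/esym/inT.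
Qed.

Lemma exists_scale N t : 0 < t <= N ->
  (2 ^ trunc_log 2 (N %/ t) * t <= N < 2 ^ (trunc_log 2 (N %/ t)).+1 * t)%N.
Proof.
move=> /andP[t0 tN]; have /andP[h1 h2] : 2 ^ trunc_log 2 (N %/ t) <= N %/ t
    < 2 ^ (trunc_log 2 (N %/ t)).+1.
  by apply: trunc_log_bounds => //; rewrite divn_gt0.
by rewrite -leq_divRL // h1 -ltn_divLR.
Qed.

(** The cube of [s]: all products [x1 ^ e1 * ... * xn ^ en] with exponents 0 or 1, listed with
    multiplicity. *)
Fixpoint subproducts s : seq G :=
  if s is x :: s' then subproducts s' ++ [seq x * y | y <- subproducts s']
  else [:: 1].

Lemma size_subproducts s : size (subproducts s) = (2 ^ size s)%N.
Proof. by elim: s => //= x s IH; rewrite size_cat size_map IH expnS mul2n addnn. Qed.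

(** Pair [y] with [x * y]. If [x] is outside [H], at least one of each pair is outside; if [x] is in
    [H], both behave alike and induction applies. *)
Lemma half_subproducts_outside H s : group_closed H -> has (outside H) s ->
  2 ^ size s <= 2 * count (outside H) (subproducts s).
Proof.
move=> gH; elim: s => //= x s IH; rewrite count_cat count_map expnS leq_mul2l /=.
case: (boolP (x \in H)) => /= xH.
  move=> /IH; rewrite mul2n -addnn => /leq_trans; apply; rewrite leq_add2l.
  by apply: sub_count => y /=; rewrite mem_mul_closedl.
move=> _; rewrite -size_subproducts -(count_predC (outside H)) leq_add2l.
apply: sub_count => y /=; rewrite negbK => yH.
by rewrite mem_mul_closedr.
Qed.

(** Each factor has its own length bound, so that lengths [2 ^ j] later add up to a geometric
    sum. *)
Lemma short_product_subproducts X (m : nat -> nat) s :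
  (forall i, i < size s -> short_product X (m i) (nth 1 s i)) ->
  forall y, y \in subproducts s ->
  short_product X (\sum_(0 <= i < size s) m i)%N y.
Proof.
elim: s m => [|x s IH] m sX y /=.
  by rewrite inE => /eqP->; apply: short_product1.
rewrite big_nat_recl //= mem_cat => /orP[ys|/mapP[z zs ->]].
  apply: short_product_leq (leq_addl _ _) _; apply: IH => // i si.
  exact: (sX i.+1).
apply: short_productM; first exact: (sX 0%N).
by apply: IH => // i si; apply: (sX i.+1).
Qed.

(** At least one entry of [X] is outside [H], so the scale of [H] is at most [trunc_log 2 (size X)].
    The family of that scale alone supplies the required elements. *)
Lemma all_scales_products X : 0 < size X ->
  exists Y, [/\ size Y = (48 * size X * (trunc_log 2 (size X)).+1)%N,
    forall y, y \in Y -> short_product X (size X) y &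
    forall H, group_closed H -> has (outside H) X ->
      (3 * size X <= count (outside H) Y)%N].
Proof.
move=> X0; have [Y YP] := choice (fun j => @scale_products X j X0).
exists (flatten [seq Y j | j <- iota 0 (trunc_log 2 (size X)).+1]); split.
- rewrite size_flatten /shape -map_comp sumnE big_map.
  rewrite (eq_bigr (fun=> 48 * size X)%N); last by move=> j _; have [] := YP j.
  by rewrite big_const_seq count_predT size_iota iter_addn_0.
- move=> y /flatten_mapP[j]; rewrite mem_iota /= add0n ltnS => jL yj.
  have [_ + _] := YP j => /(_ y yj); apply: short_product_leq.
  by apply: leq_trans (@trunc_logP 2 _ isT X0); rewrite leq_exp2l.
move=> H gH; rewrite has_count => t0.
set t := count _ X in t0 *.
have tN : (0 < t <= size X)%N by rewrite t0 count_size.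
have h := exists_scale tN; set j := trunc_log 2 _ in h.
have [_ _ /(_ H gH h)] := YP j => /leq_trans; apply.
rewrite count_flatten -map_comp sumnE big_map (bigD1_seq j) ?iota_uniq //.
  exact: leq_addr.
by rewrite mem_iota /= add0n ltnS leq_trunc_log // leq_div.
Qed.

Lemma dense_products Y c : 0 < c -> 0 < size Y ->
  exists Z, [/\ size Z = (48 * size Y * 2 ^ (trunc_log 2 c).+1)%N,
    forall z, z \in Z -> short_product Y (2 ^ (trunc_log 2 c).+1)%N z &
    forall H, group_closed H -> size Y < c.+1 * count (outside H) Y ->
      (size Z <= 32 * count (outside H) Z)%N].
Proof.
move=> c0 Y0; move defJ: (trunc_log 2 c).+1 => J.
have [Z ZP] := choice (fun j => @scale_products Y j Y0).
have szZ j : size (Z j) = (48 * size Y)%N by have [] := ZP j.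
(* Row [i] takes the [i]-th product of every scale [j < J]. *)
pose row i := mkseq (fun j => nth 1 (Z j) i) J.
pose A := flatten [seq subproducts (row i) | i <- iota 0 (48 * size Y)].
have szA : size A = (48 * size Y * 2 ^ J)%N.
  rewrite size_flatten /shape -map_comp sumnE big_map.
  rewrite (eq_bigr (fun=> 2 ^ J)%N).
    by rewrite big_const_seq count_predT size_iota iter_addn_0 mulnC.
  by move=> i _ /=; rewrite size_subproducts size_mkseq.
exists A; split=> //.
  move=> z /flatten_mapP[i]; rewrite mem_iota /= add0n => iY.
  move=> /(@short_product_subproducts Y (fun j => 2 ^ j)%N (row i)) h.
  apply: short_product_leq (h _); rewrite size_mkseq.
    elim: (J) => [|n IH]; first by rewrite big_geq.
    by rewrite big_nat_recr //= expnS mul2n -addnn leq_add2r.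
  move=> j jJ; rewrite nth_mkseq //; have [_ + _] := ZP j; apply.
  by rewrite mem_nth ?szZ.
move=> H gH lt_c; set t := count _ Y in lt_c.
have t0 : 0 < t by case: (t) lt_c => //; rewrite muln0.
have tN : (0 < t <= size Y)%N by rewrite t0 count_size.
have h := exists_scale tN; set j := trunc_log 2 _ in h.
have [_ _ /(_ H gH h)] := ZP j => le_Zj.
(* The density hypothesis says [size Y %/ t <= c], which bounds the scale. *)
have jJ : j < J.
  rewrite -defJ ltnS leq_trunc_log // -ltnS ltn_divLR // mulnC //; lia.
(* A row whose [j]-th entry is outside [H] has at least half of its [2 ^ J] subproducts outside;
   summed over rows, the [1 / 16] of [Z j] becomes [1 / 32] of [A]. *)
have le_i : 2 ^ J * count (outside H) (Z j) <= 2 * count (outside H) A.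
  have -> : Z j = mkseq (nth 1 (Z j)) (48 * size Y) by rewrite -(szZ j) mkseq_nth.
  rewrite count_flatten -map_comp sumnE big_map /mkseq.
  elim: (iota _ _) => [|i r IH]; first by rewrite big_nil /= !muln0.
  rewrite big_cons /= !mulnDr; apply: leq_add => //.
  case: (boolP (_ \in H)) => /= Zji; first by rewrite muln0.
  rewrite muln1.
  rewrite -[J in leqLHS](size_mkseq (fun j => nth 1 (Z j) i)).
  apply: half_subproducts_outside => //.
  by apply/hasP; exists (nth 1 (Z j) i) => //; apply/mapP; exists j; rewrite ?mem_iota.
rewrite szA.
have := leq_mul (leqnn (2 ^ J)) le_Zj; nia.
Qed.

End Groups.

(** * The two rounds applied to a generating set *)

Lemma is_least_exists (P : nat -> Prop) b : P b -> exists2 m, is_least P m & (m <= b)%N.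
Proof.
move=> Pb; have ex : exists n, `[< P n >] by exists b; apply/asboolP.
case: (ex_minnP ex) => m /asboolP Pm le_m.
by exists m; [split=> // i Pi|]; apply: le_m; apply/asboolP.
Qed.

Lemma proper_generates (G : groupType) (S : {fset G}) (H : {pred G}) :
  generates S -> proper_subgroup H -> has (outside H) S.
Proof.
move=> genS [gH [x /negP xH]]; apply: contrapT => /negP /hasPn SH.
by apply: xH; apply: genS => // y /SH; rewrite /= negbK.
Qed.

Lemma detecting_products (G : groupType) (S : {fset G}) (k := #|` S|) :
  generates S ->
  let L := (trunc_log 2 k).+1 in
  exists Z : seq G, [/\ (0 < size Z)%N,
    (size Z <= 48 * 48 * 32 * (k * L ^ 2) + 1)%N,
    forall z, z \in Z -> short_product S (32 * L * k) z &
    forall H, proper_subgroup H ->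
      (size Z <= 32 * count (outside H) Z)%N].
Proof.
move=> genS; move defL: (trunc_log 2 k).+1 => L.
case: (posnP k) => [k0|k_gt0].
  (* With no generators there is no proper subgroup to detect; the singleton keeps the list nonempty
     and accounts for the [+ 1] in the size bound. *)
  exists [:: 1%g]; split=> //; first by rewrite addn1.
    by move=> z; rewrite inE => /eqP->; apply: short_product1.
  move=> H /(proper_generates genS) /hasP[x].
  by rewrite (cardfs0_eq k0) inE.
have L_gt0 : (0 < L)%N by rewrite -defL.
have [Y [szY shortY outY]] := @all_scales_products G S k_gt0.
rewrite -/k defL in szY.
have Y_gt0 : (0 < size Y)%N by rewrite szY !muln_gt0 k_gt0.
(* Outside [H] lie at least [3 * k] of the [48 * k * L] entries of [Y], a proportion [1 / (16 * L)];
   this dictates [c = 16 * L]. *)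
have c_gt0 : (0 < 16 * L)%N by rewrite muln_gt0.
have [Z [szZ shortZ outZ]] := dense_products c_gt0 Y_gt0.
have leJ : (2 ^ (trunc_log 2 (16 * L)).+1 <= 32 * L)%N.
  by rewrite expnS; have := @trunc_logP 2 _ isT c_gt0; lia.
exists Z; split.
- by rewrite szZ !muln_gt0 Y_gt0 expn_gt0.
- rewrite szZ szY; move: leJ; set p := (2 ^ _)%N => leJ.
  have := leq_mul (leqnn (48 * (48 * k * L))) leJ; nia.
- move=> z /shortZ /(short_product_comp shortY); apply: short_product_leq.
  by rewrite leq_mul2r leJ orbT.
move=> H pH; have [gH _] := pH; apply: outZ => //.
have := outY H gH (proper_generates genS pH); rewrite szY -/(k).
set o := count _ _ => le_o.
apply: leq_trans (leq_mul (leqnn (16 * L).+1) le_o); nia.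
Qed.

(** * Asymptotic bounds and the detection probability *)

(** From [2 ^ t <= k] and [ln 2 >= 1 / 2] follows [t <= 2 * ln k]; the third [ln k] absorbs the
    successor. *)
Lemma trunc_log_le_ln (R : realType) (k : nat) : 1 <= ln (k%:R : R) ->
  ((trunc_log 2 k).+1)%:R <= 3 * ln (k%:R : R).
Proof.
move=> lnk; have k0 : (0 < k)%N.
  by case: k lnk => //; rewrite ln0 // ler10.
(* This is [ln (1 + x) <= x] at [x = - 1 / 2]. *)
have ln2 : 1 / 2 <= ln (2 : R).
  have := @le_ln1Dx R (- (1 / 2)) ltac:(lra).
  rewrite (_ : 1 + - (1 / 2) = 2^-1); last lra.
  by rewrite lnV ?posrE; lra.
have : ln ((2 ^ trunc_log 2 k)%:R : R) <= ln k%:R.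
  by rewrite ler_ln ?posrE ?ltr0n ?expn_gt0 // ler_nat trunc_logP.
rewrite natrX lnXn // -[ln _ *+ _]mulr_natr -[(trunc_log 2 k).+1]addn1 natrD.
set t : R := (trunc_log 2 k)%:R => ht.
have t0 : 0 <= t by rewrite /t ler0n.
have := ler_wpM2r t0 ln2; move: ht lnk; set u := ln _ * t.
set v := ln k%:R; lra.
Qed.

Lemma near_ln_ln (R : realType) :
  \forall k \near \oo, 1 <= ln (k%:R : R) /\ 1 <= ln (ln (k%:R : R)).
Proof.
near=> k.
have lek : expR (expR 1) <= k%:R :> R by near: k; exact: nbhs_infty_ger.
have k0 : 0 < k%:R :> R by apply: lt_le_trans lek; exact: expR_gt0.
have le1 : expR 1 <= ln (k%:R : R) by rewrite -ler_expR lnK.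
have l0 : 0 < ln (k%:R : R) by apply: lt_le_trans le1; exact: expR_gt0.
have le2 : 1 <= ln (ln (k%:R : R)) by rewrite -ler_expR lnK.
split=> //; apply: le_trans le1; have := expR_ge1Dx (1 : R); lra.
Unshelve. all: by end_near.
Qed.

Theorem theorem1p7 (R : realType) :
  exists n l : nat -> nat,
    [/\ (fun k => (n k)%:R : R) =O_\oo (fun k => k%:R * ln (k%:R : R) ^+ 13),
        (fun k => (l k)%:R : R) =O_\oo
          (fun k => k%:R * ln (k%:R : R) * ln (ln (k%:R : R))) &
        forall (k : nat) (G : groupType) (S : {fset G}),
          is_rank G k -> generates S -> #|` S| = k ->
          exists A : {mset G},
            [/\ (0 < size A)%N,
                (size A <= n k)%N,
                (exists2 m, is_length S A m & (m <= l k)%N) &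
                ((1 / 32)%:E <= detection R A)%E]].
Proof.
pose L k := (trunc_log 2 k).+1.
(* These are of order [k * ln k ^ 2] and [k * ln k]; the surplus factors in the claimed bounds are
   eventually at least 1. *)
exists (fun k => 48 * 48 * 32 * (k * L k ^ 2) + 1)%N, (fun k => 32 * L k * k)%N.
split.
- move: (48 * 48 * 32)%N => c; apply/eqO_exP; exists (c%:R * 9 + 1).
    by rewrite ltr_wpDl // mulr_ge0 ?ler0n.
  near=> k.
  have [x1 lx1] : 1 <= ln (k%:R : R) /\ 1 <= ln (ln (k%:R : R)).
    by near: k; exact: near_ln_ln.
  have k1 : 1 <= k%:R :> R by near: k; exact: nbhs_infty_ger.
  have := trunc_log_le_ln x1; rewrite -/(L k) => leL.
  rewrite ger0_norm ?ler0n // ger0_norm; last first.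
    by rewrite mulr_ge0 ?exprn_ge0 ?ler0n //; lra.
  rewrite natrD 2!natrM natrX; set x := ln _ in x1 lx1 leL *.
  have x2 : x ^+ 2 <= x ^+ 13 by rewrite ler_weXn2l.
  have x0 : 1 <= x ^+ 13 by rewrite exprn_ege1.
  have L2 : (L k)%:R ^+ 2 <= 9 * x ^+ 13 :> R.
    apply: le_trans (_ : (3 * x) ^+ 2 <= _).
      by rewrite lerXn2r // nnegrE ?ler0n //; lra.
    by rewrite exprMn; move: x2; set y := x ^+ 2; set z := x ^+ 13; lra.
  rewrite mulrDl mul1r; apply: lerD; last by rewrite mulr_ege1.
  by rewrite -mulrA ler_wpM2l ?ler0n // [leRHS]mulrCA ler_wpM2l ?ler0n.
- apply/eqO_exP; exists (32 * 3) => //.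
  near=> k.
  have [x1 lx1] : 1 <= ln (k%:R : R) /\ 1 <= ln (ln (k%:R : R)).
    by near: k; exact: near_ln_ln.
  have := trunc_log_le_ln x1; rewrite -/(L k) => leL.
  rewrite ger0_norm ?ler0n // ger0_norm; last first.
    by rewrite !mulr_ge0 ?ler0n //; lra.
  rewrite !natrM; set x := ln k%:R in x1 lx1 leL *.
  rewrite -!mulrA ler_wpM2l // mulrC [leRHS]mulrCA ler_wpM2l ?ler0n //.
  rewrite (le_trans leL) // ler_wpM2l // ler_peMr //; lra.
move=> k G S _ genS; case: _ /; have [Z [Z0 leZ shortZ outZ]] := detecting_products genS.
have pZ := perm_eq_seq_mset Z.
exists (seq_mset Z); rewrite (perm_size pZ); split=> //.
  apply: is_least_exists => x xZ.
  have [w [wS leS ->]] := shortZ x ltac:(by rewrite -(perm_mem pZ)).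
  by exists w; split=> //; apply/allP => y /wS yS; apply/orP; left.
apply: le_ereal_inf_tmp => _ [H pH <-]; rewrite lee_fin (perm_size pZ).
have := outZ H pH; rewrite size_filter (permP pZ).
have := count_predC (mem H) Z.
rewrite (_ : count (predC (mem H)) Z = count (outside H) Z) //.
(* [a] counts the entries inside [H] and [b] those outside; [a + b <= 32 * b] is the claimed bound
   on the ratio. *)
set a := count _ Z; set b := count _ Z => eq_ab.
rewrite -(ler_nat R) natrM -eq_ab natrD => le_b.
have ab0 : 0 < a%:R + b%:R :> R by rewrite -natrD ltr0n eq_ab.
have : a%:R / (a%:R + b%:R) <= 31 / 32 :> R by rewrite ler_pdivrMr //; lra.
lra.
Unshelve. all: by end_near.
Qed.
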